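(* Let $G$ be a finite group and $V$ a finite dimensional complex $G$-representation. Let $A$ be a $G$-algebra that is a quotient of $T(V)$, and let $Z$ be an irreducible variety parametrizing $G$-deformations up to degree $k$ of $A$. Assume that $$\forall x,y\in Z:\quad H_{A_x}(t)=H_{A_y}(t).$$ Then $Z$ parametrizes $G$-deformations of $A$; that is, for each $x\in Z$ and each $i\in\mathbb N$ one has $(A_x)_i\cong A_i$ as $G$-representations.
   Context: Everything is over $\mathbb C$. Graded algebras are positively graded, finitely generated and connected ($A_0=\mathbb C$). The Hilbert series is $H_A(t)=\sum_{i\ge 0}\dim(A_i)\,t^i$. $T(V)=\bigoplus_{i\ge0}V^{\otimes i}$ is the tensor algebra. A $G$-algebra is a connected positively graded algebra, finitely generated in degree 1, on which $G$ acts by degree-preserving algebra automorphisms; thus $A\cong T(V)/I$ with $V$ a $G$-representation and $I$ a graded $G$-stable ideal. A $G$-deformation of $A=T(V)/I$ up to degree $k$ is another quotient $B$ of $T(V)$ by a graded $G$-stable ideal with $A_i\cong B_i$ as $G$-representations for all $1\le i\le k$; $B$ is a $G$-deformation of $A$ if $A_i\cong B_i$ as $G$-representations for all $i\in\mathbb N$. For $1\le i\le k$ write $T(V)_i\cong\bigoplus_{S}S^{a_{i,S}}$ and $I_i\cong\bigoplus_S S^{e_{i,S}}$, sums over the simple $G$-representations $S$. The $G$-subrepresentations of $T(V)_i$ isomorphic to $I_i$ are parametrized by $\prod_S\mathrm{Grass}(e_{i,S},a_{i,S})$, where $\mathrm{Grass}(m,n)$ is the variety of $m$-dimensional subspaces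 of $\mathbb C^n$. Put $Z_k=\prod_{i=1}^k\prod_S\mathrm{Grass}(e_{i,S},a_{i,S})$. The $G$-deformations of $A$ up to degree $k$ are determined by points of a Zariski closed subset of $Z_k$, namely tuples $(I_1',\dots,I_k')$ with $V\otimes I'_i+I'_i\otimes V\subset I'_{i+1}$ for $i<k$; the corresponding algebra is the quotient of $T(V)$ by the two-sided ideal generated by $I_1',\dots,I_k'$. A variety $Z$ parametrizes $G$-deformations up to degree $k$ of $A$ if $Z$ is embedded as a subvariety of $Z_k$, contained in this closed subset, and the point corresponding to $A$ lies in the image (the defining relations of $A$ being generated in degrees $\le k$, so that the algebra at this point is $A$). For $x\in Z$, $A_x$ denotes the corresponding algebra. $Z$ parametrizes $G$-deformations of $A$ if, for some $k$, it parametrizes $G$-deformations of $A$ up to degree $k$ and $(A_x)_i\cong A_i$ as $G$-representations for all $x\in Z$ and $i\in\mathbb N$. *)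

(* Defs.v *)
From HB Require Import structures.
From mathcomp Require Import all_boot all_order all_algebra all_fingroup.
From mathcomp Require Import all_character.
From mathcomp Require Import classical_sets reals.
From mathcomp Require Import complex mxtens.
From mathcomp Require Import mpoly.

Set Implicit Arguments.
Unset Strict Implicit.
Unset Printing Implicit Defensive.

Import GRing.Theory.
Local Open Scope ring_scope.
Local Open Scope complex_scope.

(* Complex numbers are R[i], for R : realType.  Representations are the       *)
(* mx_representation's of mathcomp: the group acts on row vectors by right    *)
(* multiplication, and a subspace is the row space of a matrix.               *)

Section TensorAlgebra.

Variables (R : realType) (n : nat).
Local Notation C := R[i].

(* V = C^n and T(V)_i = C^(n ^ i), with the lexicographic basis of words of   *)
(* length i, so that *t is the multiplication of T(V) up to the               *)
(* identification n ^ a * n ^ b = n ^ (a + b).  On row spaces, tprod U W is   *)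
(* the span of the products u w with u in U and w in W.                       *)
Definition tprod p q a b (U : 'M[C]_(p, n ^ a)) (W : 'M[C]_(q, n ^ b)) :
    'M[C]_(p * q, n ^ (a + b)) :=
  castmx (erefl, esym (expnD n a b)) (U *t W).

Definition tfull a : 'M[C]_(n ^ a) := 1%:M.

(* A graded subspace of T(V), given by its homogeneous components.            *)
Definition graded_sub := forall i, 'M[C]_(n ^ i).

Definition graded_ideal (I : graded_sub) : Prop :=
  forall a i, (tprod (tfull a) (I i) <= I (a + i)%N)%MS
           /\ (tprod (I i) (tfull a) <= I (i + a)%N)%MS.

(* The homogeneous components J_0 = P_0 and                                   *)
(* J_(d+1) = P_(d+1) + V J_d + J_d V of the two-sided ideal generated by P;   *)
(* see gen_ideal_ideal, gen_ideal_sub and gen_ideal_min below.                *)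
Fixpoint gen_ideal (P : graded_sub) (d : nat) : 'M[C]_(n ^ d) :=
  match d with
  | 0 => P 0%N
  | d'.+1 => (P d'.+1
      + (<<(tprod (tfull 1) (gen_ideal P d') : 'M_(_, n ^ d'.+1))>>
      + <<castmx (erefl, congr1 (expn n) (addn1 d'))
            (tprod (gen_ideal P d') (tfull 1))>>))%MS
  end.

Lemma tensmxA (m1 n1 m2 n2 m3 n3 : nat) (A : 'M[C]_(m1, n1))
    (B : 'M[C]_(m2, n2)) (D : 'M[C]_(m3, n3)) :
  castmx (mulnA m1 m2 m3, mulnA n1 n2 n3) (A *t (B *t D)) = A *t B *t D.
Proof.
apply/matrixP => i j; rewrite castmxE !mxE mulrA.
congr (_ * _ * _); [congr (A _ _)|congr (B _ _)|congr (D _ _)];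
  apply: val_inj => /=; first
  [ by rewrite -divnMA; congr (_ %/ _)%N; rewrite mulnC | by rewrite modn_divl
  | by rewrite modn_dvdm ?dvdn_mull ].
Qed.

Lemma tprodA p q r a b c (U : 'M[C]_(p, n ^ a)) (W : 'M[C]_(q, n ^ b))
    (X : 'M[C]_(r, n ^ c)) :
  castmx (mulnA p q r, congr1 (expn n) (addnA a b c)) (tprod U (tprod W X))
  = tprod (tprod U W) X.
Proof.
rewrite /tprod; set e := expnD n b c; set f := expnD n a b.
have -> : U *t castmx (erefl, esym e) (W *t X)
    = castmx (erefl, congr1 (muln (n ^ a)) (esym e)) (U *t (W *t X)).
  by case: _ / (esym e); rewrite !castmx_id.
have -> : castmx (erefl, esym f) (U *t W) *t X
    = castmx (erefl, congr1 (muln^~ (n ^ c)%N) (esym f)) (U *t W *t X).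
  by case: _ / (esym f); rewrite !castmx_id.
rewrite -tensmxA !castmx_comp; congr castmx.
by congr (_, _); apply: eq_irrelevance.
Qed.

Lemma castmx_sub (J : graded_sub) p d d' (e : d = d') e'
    (U : 'M[C]_(p, n ^ d)) :
  (castmx (erefl p, e') U <= J d')%MS = (U <= J d)%MS.
Proof. by case: d' / e e' => e'; rewrite castmx_id. Qed.

Lemma tens_sub m1 m2 m3 m4 n1 n2 (A : 'M[C]_(m1, n1)) (A' : 'M[C]_(m2, n1))
    (B : 'M[C]_(m3, n2)) (B' : 'M[C]_(m4, n2)) :
  (A <= A')%MS -> (B <= B')%MS -> (A *t B <= A' *t B')%MS.
Proof.
by move=> /submxP[D ->] /submxP[E ->]; rewrite -tensmx_mul submxMl.
Qed.

Lemma tprod_sub m1 m2 m3 m4 a b (A : 'M[C]_(m1, n ^ a)) (A' : 'M[C]_(m2, n ^ a))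
    (B : 'M[C]_(m3, n ^ b)) (B' : 'M[C]_(m4, n ^ b)) :
  (A <= A')%MS -> (B <= B')%MS -> (tprod A B <= tprod A' B')%MS.
Proof.
move=> sA sB; rewrite /tprod; move: (tens_sub sA sB).
by case: _ / (esym _) => /=; rewrite !castmx_id.
Qed.

Lemma castmx_subl m1 m1' n1 q (e : m1 = m1') (A : 'M[C]_(m1, n1))
    (B : 'M[C]_(q, n1)) : (castmx (e, erefl) A <= B)%MS = (A <= B)%MS.
Proof. by rewrite eqmx_cast. Qed.

Lemma tprod_subA (J : graded_sub) p q r a b c (U : 'M[C]_(p, n ^ a))
    (W : 'M[C]_(q, n ^ b)) (X : 'M[C]_(r, n ^ c)) :
  (tprod (tprod U W) X <= J (a + b + c)%N)%MS =
  (tprod U (tprod W X) <= J (a + (b + c))%N)%MS.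
Proof.
rewrite -tprodA -(castmx_sub J (addnA a b c) (congr1 (expn n) (addnA a b c))).
rewrite -(castmx_subl (mulnA p q r)) castmx_comp.
by congr (_ <= _)%MS; congr castmx; congr (_, _); apply: eq_irrelevance.
Qed.

Lemma tfullM a b : (tfull (a + b) <= tprod (tfull a) (tfull b))%MS.
Proof.
rewrite /tprod /tfull.
have -> : (1%:M : 'M[C]_(n ^ a)) *t (1%:M : 'M[C]_(n ^ b)) = 1%:M.
  apply/matrixP => i j.
  case: (mxtens_indexP i) => i0 i1; case: (mxtens_indexP j) => j0 j1.
  rewrite tensmxE !mxE -natrM mulnb -xpair_eqE.
  by rewrite (inj_eq (can_inj (@mxtens_indexK _ _))).
by case: _ / (esym _); rewrite castmx_id.
Qed.

Lemma gen_ideal_sub P i : (P i <= gen_ideal P i)%MS.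
Proof. by case: i => // i; rewrite /= addsmxSl. Qed.

Lemma gen_idealVl P i :
  (tprod (tfull 1) (gen_ideal P i) <= gen_ideal P (1 + i))%MS.
Proof.
have := addsmxSr (P i.+1) (<<(tprod (tfull 1) (gen_ideal P i)
  : 'M_(_, n ^ i.+1))>> + <<castmx (erefl, congr1 (expn n) (addn1 i))
            (tprod (gen_ideal P i) (tfull 1))>>)%MS.
by apply: submx_trans; apply: submx_trans (addsmxSl _ _); rewrite genmxE.
Qed.

Lemma gen_idealVr P i :
  (tprod (gen_ideal P i) (tfull 1) <= gen_ideal P (i + 1))%MS.
Proof.
rewrite -(castmx_sub _ (addn1 i) (congr1 (expn n) (addn1 i))) /=.
apply: submx_trans (addsmxSr _ _); apply: submx_trans (addsmxSr _ _).
by rewrite genmxE.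
Qed.

Lemma gen_ideal_ideal P : graded_ideal (gen_ideal P).
Proof.
elim=> [|a IH] i.
  split.
    rewrite /tprod tens_scalar_mx scale1r castmx_comp.
    rewrite -(castmx_subl (mul1n _)) castmx_comp.
    by rewrite castmx_id.
  rewrite /tprod tens_mx_scalar scale1r castmx_comp.
  rewrite -(castmx_subl (muln1 _)) castmx_comp.
  set e := etrans _ _; rewrite (eq_irrelevance e erefl).
  by rewrite (castmx_sub _ (esym (addn0 i))).
split.
  apply: submx_trans (tprod_sub (tfullM 1 a) (submx_refl _)) _.
  rewrite (tprod_subA (gen_ideal P) (tfull 1)).
  apply: submx_trans (gen_idealVl P (a + i)).
  exact: tprod_sub (submx_refl _) (IH i).1.
apply: submx_trans (tprod_sub (submx_refl _) (tfullM 1 a)) _.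
rewrite -(tprod_subA (gen_ideal P) _ (tfull 1)).
apply: submx_trans (IH (i + 1)%N).2.
exact: tprod_sub (gen_idealVr P i) (submx_refl _).
Qed.

Lemma gen_ideal_min P I : graded_ideal I -> (forall i, (P i <= I i)%MS) ->
  forall i, (gen_ideal P i <= I i)%MS.
Proof.
move=> idI sPI; elim=> [|i IH] //=.
rewrite !addsmx_sub sPI !genmxE /=; apply/andP; split.
  exact: submx_trans (tprod_sub (submx_refl _) IH) (idI 1 i).1.
rewrite (castmx_sub _ (addn1 i)).
exact: submx_trans (tprod_sub IH (submx_refl _)) (idI 1 i).2.
Qed.

Lemma ntens_succ (A : 'M[C]_n) k :
  A ^t k.+1 = castmx (esym (expnS n k), esym (expnS n k)) (A *t A ^t k).
Proof.
case: k => [|k]; last by rewrite ntensmxSS castmx_id.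
rewrite ntensmx0 ntensmx1 tens_mx_scalar scale1r castmx_comp.
by rewrite [X in (X, _)](eq_irrelevance _ erefl) castmx_id.
Qed.

Lemma ntensmx_id k : (1%:M : 'M[C]_n) ^t k = 1%:M.
Proof.
elim: k => // k IH; rewrite ntens_succ IH.
have -> : (1%:M : 'M[C]_n) *t (1%:M : 'M[C]_(n ^ k)) = 1%:M.
  apply/matrixP => i j.
  case: (mxtens_indexP i) => i0 i1; case: (mxtens_indexP j) => j0 j1.
  rewrite tensmxE !mxE -natrM mulnb -xpair_eqE.
  by rewrite (inj_eq (can_inj (@mxtens_indexK _ _))).
by case: _ / (esym _); rewrite castmx_id.
Qed.

Lemma ntensmxM (A B : 'M[C]_n) k : (A *m B) ^t k = A ^t k *m B ^t k.
Proof.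
elim: k => [|k IH]; first by rewrite !ntensmx0 mulmx1.
rewrite !ntens_succ IH -tensmx_mul.
by case: _ / (esym (expnS n k)); rewrite !castmx_id.
Qed.

Lemma ntensmxD (A : 'M[C]_n) a b :
  A ^t (a + b) = castmx (esym (expnD n a b), esym (expnD n a b))
                   (A ^t a *t A ^t b).
Proof.
elim: a => [|a IH].
  rewrite ntensmx0 tens_scalar_mx scale1r castmx_comp.
  by rewrite castmx_id.
rewrite [LHS](ntens_succ A (a + b)) ntens_succ IH.
set e := expnD n a b; set f := expnS n a; set h := expnD _ _ _.
have -> : A *t castmx (esym e, esym e) (A ^t a *t A ^t b)
    = castmx (congr1 (muln n) (esym e), congr1 (muln n) (esym e))
             (A *t (A ^t a *t A ^t b)).
  by case: _ / (esym e); rewrite !castmx_id.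
have -> : castmx (esym f, esym f) (A *t A ^t a) *t A ^t b
    = castmx (congr1 (muln^~ (n ^ b)%N) (esym f),
              congr1 (muln^~ (n ^ b)%N) (esym f)) (A *t A ^t a *t A ^t b).
  by case: _ / (esym f); rewrite !castmx_id.
rewrite -tensmxA !castmx_comp; congr castmx.
by congr (_, _); apply: eq_irrelevance.
Qed.

Lemma tprod_mul p q a b (U : 'M[C]_(p, n ^ a)) (W : 'M[C]_(q, n ^ b))
    (A : 'M[C]_n) :
  tprod U W *m (A ^t (a + b)) = tprod (U *m A ^t a) (W *m A ^t b).
Proof.
rewrite /tprod -tensmx_mul ntensmxD.
by case: _ / (esym (expnD n a b)); rewrite !castmx_id.
Qed.

End TensorAlgebra.

Section Representations.

Variables (R : realType) (gT : finGroupType) (G : {group gT}).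
Local Notation C := R[i].

Section TensorRepr.

Variables (n : nat) (rV : mx_representation C G n).

Lemma tens_mx_repr i : mx_repr G (fun g => rV g ^t i).
Proof.
split=> [|g h gG hG]; first by rewrite repr_mx1 ntensmx_id.
by rewrite repr_mxM // ntensmxM.
Qed.
Definition tens_repr i : mx_representation C G (n ^ i) :=
  MxRepresentation (tens_mx_repr i).

Definition G_stable (I : graded_sub R n) : Prop :=
  forall i, mxmodule (tens_repr i) (I i).

(* The G-algebra A = T(V)/I, represented by the homogeneous ideal I; A_0 = C  *)
(* means that I_0 = 0.                                                        *)
Record G_algebra := GAlgebra {
  relations :> forall i, 'M[C]_(n ^ i);
  relations0 : relations 0%N = 0;
  relations_ideal : graded_ideal relations;
  relations_stable : G_stable relations }.

(* The G-representation on A_i = T(V)_i / I_i. *)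
Definition piece_repr (A : G_algebra) i :
    mx_representation C G (\rank (cokermx (A i))) :=
  factmod_repr (relations_stable A i).

(* The coefficient sequence of the Hilbert series: the degree of the          *)
(* representation A_i.                                                        *)
Definition hilbert_series (A : G_algebra) (i : nat) : nat :=
  \rank (cokermx (A i)).

Lemma gen_ideal_stable P : G_stable P -> G_stable (gen_ideal P).
Proof.
move=> stP; elim=> [|i IH] /=; first exact: stP.
apply: addsmx_module; first exact: stP.
apply: addsmx_module; rewrite (eqmx_module _ (genmxE _)); apply/mxmoduleP => g gG.
  have := tprod_mul (tfull R n 1) (gen_ideal P i) (rV g).
  rewrite [tens_repr _ _]/= => ->.
  exact: (tprod_sub (submx1 _) (mxmoduleP IH g gG)).
have -> : castmx (erefl, congr1 (expn n) (addn1 i))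
      (tprod (gen_ideal P i) (tfull R n 1)) *m tens_repr i.+1 g =
    castmx (erefl, congr1 (expn n) (addn1 i))
      (tprod (gen_ideal P i) (tfull R n 1) *m (rV g ^t (i + 1))).
  by rewrite /=; case: _ / (addn1 i); rewrite !castmx_id.
rewrite tprod_mul; set e := congr1 _ _.
have: (tprod (gen_ideal P i *m rV g ^t i) (tfull R n 1 *m rV g ^t 1)
        <= tprod (gen_ideal P i) (tfull R n 1))%MS.
  rewrite tprod_sub //; first exact: (mxmoduleP IH).
  by rewrite /tfull mul1mx submx1.
by case: _ / e; rewrite !castmx_id.
Qed.

End TensorRepr.

Definition homG m p (rM : mx_representation C G m)
    (rN : mx_representation C G p) : {vspace 'M[C]_(m, p)} :=
  (\bigcap_(g in G) lker (linfun (mulmx (rM g) \- mulmxr (rN g))))%VS.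

Definition simples : irrType C G := DecSocleType (regular_repr C G).

(* The multiplicity of a simple S in N, i.e. dim Hom_G(S, N) since the field  *)
(* is algebraically closed.                                                   *)
Definition mult p (S : simples) (rN : mx_representation C G p) : nat :=
  \dim (homG (irr_repr S) rN).

End Representations.

Section Grassmannians.

Variable F : fieldType.

(* Grass(m, a): the m-dimensional subspaces of F^a. *)
Definition grass (m a : nat) : Type := {W : {vspace 'rV[F]_a} | \dim W == m}.

(* The Pluecker coordinate, with respect to the basis b, indexed by a         *)
(* sequence J of columns; sequences that are not increasing only contribute   *)
(* zeros and, up to sign, repetitions.                                        *)
Definition plucker m a (b : m.-tuple 'rV[F]_a) (J : {ffun 'I_m -> 'I_a}) : F :=
  \det (\matrix_(r, c) tnth b r 0 (J c)).

Variables (B : finType) (m a : B -> nat).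

Definition grass_prod : Type := forall b : B, grass (m b) (a b).

Definition plucker_index : finType := {b : B & {ffun 'I_(m b) -> 'I_(a b)}}.

Definition plucker_coord (u : forall b, (m b).-tuple 'rV[F]_(a b))
    (v : 'I_#|plucker_index|) : F :=
  let: existT b J := enum_val v in plucker (u b) J.

(* A polynomial in the multihomogeneous Pluecker coordinates vanishes at x if *)
(* it vanishes for every choice of homogeneous coordinates of x: a change of  *)
(* basis of sval (x b) rescales the coordinates of the factor b.              *)
Definition poly_vanishes (P : {mpoly F[#|plucker_index|]}) (x : grass_prod) :
    Prop :=
  forall u : (forall b, (m b).-tuple 'rV[F]_(a b)),
    (forall b, basis_of (sval (x b)) (u b)) -> P.@[plucker_coord u] = 0.

Definition zariski_closed (D : set grass_prod) : Prop :=
  exists E : set {mpoly F[#|plucker_index|]},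
    forall x, D x <-> (forall P, E P -> poly_vanishes P x).

(* Subvarieties are the locally closed subsets. *)
Definition subvariety (Z : set grass_prod) : Prop :=
  exists D1 D2, [/\ zariski_closed D1, zariski_closed D2 & Z = (D1 `\` D2)%classic].

Definition irreducible (Z : set grass_prod) : Prop :=
  (Z !=set0)%classic /\
  forall D1 D2, zariski_closed D1 -> zariski_closed D2 ->
    (Z `<=` D1 `|` D2)%classic -> (Z `<=` D1)%classic \/ (Z `<=` D2)%classic.

End Grassmannians.

Section Deformations.

Variables (R : realType) (gT : finGroupType) (G : {group gT}) (n : nat).
Local Notation C := R[i].
Variables (rV : mx_representation C G n) (A : G_algebra rV) (k : nat).

(* The factors of Z_k are indexed by a degree i.+1, with i < k, and a simple  *)
(* representation S.                                                          *)
Definition block : finType := ('I_k * simples R G)%type.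

(* The exponents of S in I_i, resp. T(V)_i, with i = b.1.+1 and S = b.2.     *)
Definition mult_rel (b : block) : nat :=
  mult b.2 (submod_repr (relations_stable A b.1.+1)).
Definition mult_tens (b : block) : nat := mult b.2 (tens_repr rV b.1.+1).

Definition Zk : Type := grass_prod C mult_rel mult_tens.

(* The subrepresentation of the S-isotypic part of N attached to a subspace   *)
(* W of the multiplicity space C^a of S in N, identified with Hom_G(S, N) by  *)
(* the basis vbasis (homG _ _): the sum of the images of the f in W.          *)
Definition isotypic_sub p (S : simples R G) (rN : mx_representation C G p)
    (W : {vspace 'rV[C]_(mult S rN)}) : 'M[C]_p :=
  (\sum_(w <- vbasis W)
     <<\sum_(c < mult S rN) w 0 c *: tnth (vbasis (homG (irr_repr S) rN)) c>>)%MS.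

(* The component I'_i of the point x, 1 <= i <= k; it is 0 in other degrees.  *)
Definition point_rel (x : Zk) : graded_sub R n := fun d =>
  match d return 'M[C]_(n ^ d) with
  | 0 => 0
  | i.+1 =>
    if @idP (i < k)%N is ReflectT lt_ik then
      (\sum_(S : simples R G)
         @isotypic_sub _ S (tens_repr rV i.+1) (sval (x (Ordinal lt_ik, S))))%MS
    else 0
  end.

Lemma homGP p (rN : mx_representation C G p) m (rM : mx_representation C G m) f :
  f \in homG rM rN -> forall g, g \in G -> rM g *m f = f *m rN g.
Proof.
by move/subv_bigcapP => hf g gG; move/(_ g gG): hf; rewrite -memvE memv_ker lfunE
  /= subr_eq0 => /eqP.
Qed.

Lemma isotypic_sub_stable p (S : simples R G) (rN : mx_representation C G p) W :
  mxmodule rN (@isotypic_sub p S rN W).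
Proof.
rewrite /isotypic_sub big_seq; elim/big_ind: _ => [|U V|w _].
- exact: mxmodule0.
- exact: addsmx_module.
rewrite (eqmx_module _ (genmxE _)); apply/mxmoduleP => g gG.
set f := \sum_(c < _) _; have /homGP <- // : f \in homG (irr_repr S) rN.
  apply: memv_suml => c _; apply: memvZ; apply: vbasis_mem; exact: mem_tnth.
exact: submxMl.
Qed.

Lemma point_rel_stable x : G_stable rV (point_rel x).
Proof.
case=> [|i] /=; first exact: mxmodule0.
have reflect_ind b (r : reflect (i < k)%N b) (f : (i < k)%N -> 'M[C]_(n ^ i.+1)) :
    (forall lt_ik, mxmodule (tens_repr rV i.+1) (f lt_ik)) ->
    mxmodule (tens_repr rV i.+1) (if r is ReflectT lt_ik then f lt_ik else 0).
  by case: r => [lt_ik ->|_ _] //; apply: mxmodule0.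
apply: (reflect_ind _ idP) => lt_ik.
by apply: sumsmx_module => S _; apply: isotypic_sub_stable.
Qed.

(* A_x: the quotient of T(V) by the ideal generated by I'_1, ..., I'_k. *)
Definition algebra_at (x : Zk) : G_algebra rV :=
  @GAlgebra _ _ _ _ _ (gen_ideal (point_rel x)) erefl
    (gen_ideal_ideal (point_rel x)) (gen_ideal_stable (point_rel_stable x)).

(* The closed subset of Z_k: V I'_i + I'_i V is contained in I'_(i+1). *)
Definition deformation_locus : set Zk := fun x =>
  forall i, (0 < i < k)%N ->
    (tprod (tfull R n 1) (point_rel x i) <= point_rel x (1 + i)%N)%MS
    /\ (tprod (point_rel x i) (tfull R n 1) <= point_rel x (i + 1)%N)%MS.

(* The point x corresponds to A, and the relations of A are generated in      *)
(* degrees <= k, so that A_x = A.                                             *)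
Definition is_point_of (x : Zk) : Prop :=
  (forall i, (0 < i <= k)%N -> (point_rel x i :=: A i)%MS)
  /\ (forall i, (algebra_at x i :=: A i)%MS).

Definition parametrizes_up_to (Z : set Zk) : Prop :=
  [/\ subvariety Z, (Z `<=` deformation_locus)%classic
    & exists2 x, Z x & is_point_of x].

Definition parametrizes (Z : set Zk) : Prop :=
  parametrizes_up_to Z /\
  forall x, Z x -> forall i, mx_rsim (piece_repr (algebra_at x) i) (piece_repr A i).

End Deformations.

(* Main.v *)
From HB Require Import structures.
Require Import Defs.
From mathcomp Require Import all_boot all_order all_algebra all_fingroup pgroup.
From mathcomp Require Import all_character.
From mathcomp Require Import classical_sets reals complex mxtens mpoly.

Set Implicit Arguments.
Unset Strict Implicit.
Unset Printing Implicit Defensive.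

Import GRing.Theory.
Local Open Scope ring_scope.

(** Fix a degree d and a simple representation S, and let E_S be the action on
T(V)_d of the central idempotent of the group ring attached to S.  For a point x
of Z with ideal I(x), the space I(x)_d E_S is the S-isotypic part of I(x)_d and
I(x)_d (1 - E_S) is the sum of its other isotypic parts, so that
<<
      rank (I(x)_d E_S) + rank (I(x)_d (1 - E_S)) = dim I(x)_d
>>
([rank_isotypic_proj_compl]), which is constant on Z because the Hilbert series
is.  Both ranks are lower semicontinuous in x; since their sum is constant, the
set where the first one is at most r and the set where it is at least r + 1 are
both closed in Z.  They cover Z and they are disjoint, so by irreducibility one
of them is Z, and the first rank is constant on Z ([irreducible_const]).  Thus
I(x)_d has the same isotypic ranks as the ideal of A in degree d.  Subtracting
from T(V)_d, the quotients (A_x)_d and A_d have the same isotypic ranks, and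
these determine a representation up to isomorphism, by Maschke's theorem
([factmod_rsim_of_rank_isotypic]).

Semicontinuity has to be read off from Pluecker coordinates, as closed sets are
defined by polynomials in these.  Cramer's rule shows that a subspace is spanned
by vectors whose entries are Pluecker coordinates of the subspace
([span_plucker_vector]).  The operations which build I(x)_d from the subspaces
x consists of (sums, tensor products, multiplication by constant matrices)
preserve the property of being the row space of a matrix with polynomial entries
in the Pluecker coordinates ([polynomial_family]).  A rank bound on such a
matrix is the vanishing of its minors ([zariski_closed_rank_le]). *)

(** * Ranks and minors *)

Section Minors.

Variable F : fieldType.

Lemma mxrank_coker_inj m q p (A : 'M[F]_(m, p)) (B : 'M[F]_(q, p)) :
  \rank (cokermx A) = \rank (cokermx B) -> \rank A = \rank B.
Proof.
rewrite (mxrank_coker A) (mxrank_coker B) => eq_coker.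
by rewrite -(subKn (rank_leq_col A)) eq_coker subKn ?rank_leq_col.
Qed.

Lemma row_free_unit_minor m a (A : 'M[F]_(m, a)) : row_free A ->
  exists J : {ffun 'I_m -> 'I_a}, colsub J A \in unitmx.
Proof.
rewrite /row_free -mxrank_tr => full_At; exists (fullrankfun full_At).
by rewrite -unitmx_tr trmx_mxsub fullrowsub_unit.
Qed.

Lemma mxrank_mxsub m p m' p' (f : 'I_m' -> 'I_m) (g : 'I_p' -> 'I_p)
    (A : 'M[F]_(m, p)) : (\rank (mxsub f g A) <= \rank A)%N.
Proof.
have sub_rows q q' s (h : 'I_q' -> 'I_q) (B : 'M[F]_(q, s)) :
    (\rank (rowsub h B) <= \rank B)%N.
  by apply/mxrankS/row_subP => i; rewrite row_rowsub row_sub.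
rewrite mxsubrc; apply: leq_trans (sub_rows _ _ _ f _) _.
by rewrite -mxrank_tr trmx_mxsub -[leqRHS]mxrank_tr sub_rows.
Qed.

Lemma row_free_rowsub m p m' (f : 'I_m' -> 'I_m) (A : 'M[F]_(m, p)) :
  injective f -> row_free A -> row_free (rowsub f A).
Proof.
move=> inj_f /row_freeP[D AD1]; apply/row_freeP; exists (colsub f D).
have := mxsub_mul f f A D; rewrite AD1 => <-.
by apply/matrixP => i j; rewrite !mxE (inj_eq inj_f).
Qed.

Lemma mxrank_le_minors m p r (A : 'M[F]_(m, p)) :
  (\rank A <= r)%N <->
  forall (f : {ffun 'I_r.+1 -> 'I_m}) (g : {ffun 'I_r.+1 -> 'I_p}),
    \det (mxsub f g A) = 0.
Proof.
split=> [rankA f g | minors0].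
  apply/eqP; rewrite -[_ == 0]negbK -unitfE -unitmxE -row_free_unit.
  apply/negP => /eqP rank_fg; have := mxrank_mxsub f g A.
  by rewrite rank_fg leqNgt ltnS rankA.
rewrite leqNgt; apply/negP => lt_r.
pose f : {ffun 'I_r.+1 -> 'I_m} := [ffun i => maxrankfun A (widen_ord lt_r i)].
have free_f : row_free (rowsub f A).
  rewrite mxsub_ffunl rowsub_comp row_free_rowsub ?maxrowsub_free //.
  by move=> i j /(congr1 val)/= /val_inj.
have [g] := row_free_unit_minor free_f.
by rewrite -mxsubcr unitmxE minors0 unitr0.
Qed.

End Minors.

(** * A subspace is spanned by vectors of Pluecker coordinates *)

Section PlueckerSpan.

Variables (F : fieldType) (m a : nat).

Definition set_index (J : {ffun 'I_m -> 'I_a}) i c : {ffun 'I_m -> 'I_a} :=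
  [ffun j => if j == i then c else J j].

(** Expanding the determinant along the column i: replacing that column changes
neither the cofactors of its entries nor, therefore, row i of the adjugate. *)
Lemma cramer_col (U : 'M[F]_(m, a)) (J : {ffun 'I_m -> 'I_a}) i c :
  (\adj (colsub J U) *m U) i c = \det (colsub (set_index J i c) U).
Proof.
rewrite (expand_det_col _ i) mxE; apply: eq_bigr => r _.
rewrite !mxE ffunE eqxx mulrC; congr (_ * _).
rewrite /cofactor; congr (_ * \det _); apply/matrixP => s t.
by rewrite !mxE !ffunE eq_sym (negPf (neq_lift i t)).
Qed.

(** The pair (J, i) stands for row i of the matrix \adj U_J *m U, where U_J
consists of the columns J of U. *)
Definition minor_row : finType := ({ffun 'I_m -> 'I_a} * 'I_m)%type.

Definition plucker_vector (b : m.-tuple 'rV[F]_a) (J : minor_row) : 'rV[F]_a :=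
  \row_c plucker b (set_index J.1 J.2 c).

(** Let U be the matrix whose rows are the basis b.  The vectors on the left are
the rows of the products \adj U_J *m U, so they lie in the row space of U.  As U
has full rank, some U_J is invertible, and then so is \adj U_J: the rows for
this J already span. *)
Lemma span_plucker_vector (W : {vspace 'rV[F]_a}) (b : m.-tuple 'rV[F]_a) :
  basis_of W b ->
  <<map (plucker_vector b) (index_enum minor_row)>>%VS = W.
Proof.
move=> basis_b; pose U : 'M[F]_(m, a) := \matrix_r tnth b r.
have pluckerE J : plucker b J = \det (colsub J U).
  by rewrite /plucker; congr (\det _); apply/matrixP => r c; rewrite !mxE.
have vecE J i : plucker_vector b (J, i) = row i (\adj (colsub J U) *m U).
  by apply/rowP => c; rewrite [RHS]mxE cramer_col mxE /= pluckerE.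
have rowU r : row r U = tnth b r by rewrite rowK.
apply: subv_anti; apply/andP; split.
  apply/span_subvP => _ /mapP[[J i] _ ->]; rewrite vecE row_mul mulmx_sum_row.
  apply: memv_suml => r _; rewrite rowU memvZ //.
  by apply: (basis_mem basis_b); apply: mem_tnth.
have free_U : row_free U.
  rewrite -kermx_eq0; apply/rowV0P => v /sub_kermxP.
  rewrite mulmx_sum_row => v0.
  apply/rowP => r; rewrite mxE; have /freeP free_b := basis_free basis_b.
  apply: (free_b (fun r => v 0 r)).
  by rewrite -[RHS]v0; apply: eq_bigr => r' _; rewrite rowU (tnth_nth 0).
have [J unitJ] := row_free_unit_minor free_U.
rewrite -(span_basis basis_b); apply/span_subvP => _ /tnthP[r ->].
have -> : tnth b r = row r ((\det (colsub J U))^-1 *: colsub J U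
                            *m (\adj (colsub J U) *m U)).
  rewrite mulmxA -scalemxAl mul_mx_adj scale_scalar_mx.
  by rewrite mulVf ?mul1mx ?rowU // -unitfE -unitmxE.
rewrite row_mul mulmx_sum_row; apply: memv_suml => i _; rewrite memvZ // -vecE.
by apply: memv_span; apply: map_f; apply: mem_index_enum.
Qed.

End PlueckerSpan.

(** * Families of subspaces given by polynomial matrices *)

Local Notation eval_mx v P := (map_mx (meval v) P).

(** The coordinates of a point are a relation because homogeneous coordinates
are only determined up to scaling: the same polynomial matrix P must define U x
for every choice of them.  Only row spaces count, hence the freedom in the
number s of rows. *)
Definition polynomial_family (F : fieldType) N X
    (coords : X -> ('I_N -> F) -> Prop) q p (U : X -> 'M[F]_(q, p)) : Prop :=
  exists s (P : 'M[{mpoly F[N]}]_(s, p)),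
    forall x v, coords x v -> (eval_mx v P :=: U x)%MS.

Section PolynomialFamilies.

Variables (F : fieldType) (N : nat) (X : Type).
Variable coords : X -> ('I_N -> F) -> Prop.

Lemma polynomial_family_eqmx q q' p (U : X -> 'M[F]_(q, p))
    (W : X -> 'M[F]_(q', p)) :
  (forall x, (U x :=: W x)%MS) ->
  polynomial_family coords U -> polynomial_family coords W.
Proof.
move=> eqUW [s [P defU]]; exists s, P => x v xv.
exact: eqmx_trans (defU x v xv) (eqUW x).
Qed.

(** With the relation eq, a family is parametrized by the coordinate vectors
themselves.  A family that can be written in terms of the coordinates of x is
treated there first, and then carried over to the points x. *)
Lemma polynomial_family_coords q q' p (V : ('I_N -> F) -> 'M[F]_(q, p))
    (U : X -> 'M[F]_(q', p)) :
  polynomial_family eq V -> (forall x v, coords x v -> (V v :=: U x)%MS) ->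
  polynomial_family coords U.
Proof.
move=> [s [P defV]] eqVU; exists s, P => x v xv.
exact: eqmx_trans (defV v v erefl) (eqVU x v xv).
Qed.

Lemma eval_mx_const v q p (A : 'M[F]_(q, p)) :
  eval_mx v (map_mx (@mpolyC N F) A) = A.
Proof. by apply/matrixP => i j; rewrite !mxE mevalC. Qed.

Lemma polynomial_family_const q p (A : 'M[F]_(q, p)) :
  polynomial_family coords (fun=> A).
Proof.
exists q, (map_mx (@mpolyC N F) A) => x v _.
by rewrite eval_mx_const.
Qed.

Lemma polynomial_family_genmx q p (U : X -> 'M[F]_(q, p)) :
  polynomial_family coords U -> polynomial_family coords (fun x => <<U x>>%MS).
Proof. by apply: polynomial_family_eqmx => x; apply/eqmx_sym/genmxE. Qed.

Lemma polynomial_family_adds q q' p (U : X -> 'M[F]_(q, p))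
    (W : X -> 'M[F]_(q', p)) :
  polynomial_family coords U -> polynomial_family coords W ->
  polynomial_family coords (fun x => (U x + W x)%MS).
Proof.
move=> [s [P defU]] [t [Q defW]]; exists (s + t)%N, (col_mx P Q) => x v xv.
rewrite map_col_mx; apply: eqmx_trans (eqmx_sym (addsmxE _ _)) _.
exact: adds_eqmx (defU x v xv) (defW x v xv).
Qed.

Lemma polynomial_family_sums (I : Type) (r : seq I) p (U : I -> X -> 'M[F]_p) :
  (forall i, polynomial_family coords (U i)) ->
  polynomial_family coords (fun x => \sum_(i <- r) U i x)%MS.
Proof.
move=> polyU; elim: r => [|i r IH].
  apply: polynomial_family_eqmx (polynomial_family_const (0 : 'M_p)) => x.
  by rewrite big_nil.
apply: polynomial_family_eqmx (polynomial_family_adds (polyU i) IH) => x.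
by rewrite big_cons.
Qed.

Lemma polynomial_family_mulmxr q p p' (E : 'M[F]_(p, p'))
    (U : X -> 'M[F]_(q, p)) :
  polynomial_family coords U -> polynomial_family coords (fun x => U x *m E).
Proof.
move=> [s [P defU]]; exists s, (P *m map_mx (@mpolyC N F) E) => x v xv.
have -> : eval_mx v (P *m map_mx (@mpolyC N F) E) = eval_mx v P *m E.
  by rewrite map_mxM; congr (_ *m _); apply: eval_mx_const.
exact: eqmxMr (defU x v xv).
Qed.

Lemma polynomial_family_castmx q p p' (e : p = p') (U : X -> 'M[F]_(q, p)) :
  polynomial_family coords U ->
  polynomial_family coords (fun x => castmx (erefl, e) (U x)).
Proof.
case: p' / e => polyU; apply: polynomial_family_eqmx polyU => x.
by rewrite castmx_id.
Qed.

Lemma polynomial_family_tens q q' p p' (U : X -> 'M[F]_(q, p))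
    (W : X -> 'M[F]_(q', p')) :
  polynomial_family coords U -> polynomial_family coords W ->
  polynomial_family coords (fun x => U x *t W x).
Proof.
move=> [s [P defU]] [t [Q defW]]; exists (s * t)%N, (P *t Q) => x v xv.
have -> : eval_mx v (P *t Q) = eval_mx v P *t eval_mx v Q.
  by apply/matrixP => i j; rewrite !mxE mevalM.
have tensS m1 m2 m3 m4 n1 n2 (A : 'M[F]_(m1, n1)) (A' : 'M_(m2, n1))
    (B : 'M_(m3, n2)) (B' : 'M_(m4, n2)) :
    (A <= A')%MS -> (B <= B')%MS -> (A *t B <= A' *t B')%MS.
  by move=> /submxP[D ->] /submxP[D' ->]; rewrite -tensmx_mul submxMl.
by apply/eqmxP; rewrite !tensS ?(defU x v xv) ?(defW x v xv).
Qed.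

End PolynomialFamilies.

(** * Images of a subspace under a matrix-valued linear map *)

Section RowCombinations.

Variables (F : fieldType) (q p a : nat) (f : 'I_a -> 'M[F]_(q, p)).

Definition row_comb (w : 'rV[F]_a) : 'M[F]_(q, p) := \sum_c w 0 c *: f c.

Lemma row_comb_is_linear : linear row_comb.
Proof.
move=> k u v; rewrite /row_comb scaler_sumr -big_split /=.
by apply: eq_bigr => c _; rewrite !mxE scalerDl scalerA.
Qed.

HB.instance Definition _ :=
  GRing.isLinear.Build F 'rV[F]_a 'M[F]_(q, p) *:%R row_comb row_comb_is_linear.

(** Linearity makes the sum of the row spaces of the row_comb w, for w in a
spanning sequence, independent of that sequence.  So the basis in terms of which
it is written can be traded for the vectors of Pluecker coordinates. *)
Lemma sum_row_comb_sub (s t : seq 'rV[F]_a) :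
  (<<s>> <= <<t>>)%VS ->
  (\sum_(w <- s) <<row_comb w>> <= \sum_(w <- t) <<row_comb w>>)%MS.
Proof.
move=> /subvP sub_st; rewrite big_seq.
elim/big_rec: _ => [|w M w_s]; first exact: sub0mx.
rewrite addsmx_sub => ->; rewrite andbT genmxE.
have /coord_span -> : w \in <<in_tuple t>>%VS.
  by apply: sub_st; apply: memv_span.
rewrite linear_sum summx_sub // => i _; rewrite linearZ scalemx_sub //=.
rewrite (big_rem _ (mem_nth 0 (ltn_ord i))) /=.
by apply: submx_trans (addsmxSl _ _); rewrite genmxE.
Qed.

Lemma polynomial_family_row_comb N (h : 'I_a -> 'I_N) :
  polynomial_family eq (fun v : 'I_N -> F => row_comb (\row_c v (h c))).
Proof.
exists q, (\sum_c 'X_(h c) *: map_mx (@mpolyC N F) (f c)) => _ v ->.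
rewrite map_mx_sum; set S := (X in (X :=: _)%MS).
suff -> : S = row_comb (\row_c v (h c)) by [].
apply: eq_bigr => c _; apply/matrixP => i j.
by rewrite !mxE /= mevalM mevalXU mevalC.
Qed.

End RowCombinations.

(** * Closed conditions on products of Grassmannians *)

Section ClosedRank.

Variables (F : fieldType) (B : finType) (m a : B -> nat).

Definition plucker_coords (x : grass_prod F m a)
    (v : 'I_#|plucker_index m a| -> F) : Prop :=
  exists2 u : (forall b, (m b).-tuple 'rV[F]_(a b)),
    forall b, basis_of (sval (x b)) (u b) & v = plucker_coord u.

(** The equations are the minors of size r + 1 of a matrix P defining U.  Their
vanishing for one choice of bases gives the rank bound, which in turn gives their
vanishing for every other choice. *)
Lemma zariski_closed_rank_le q p (U : grass_prod F m a -> 'M[F]_(q, p)) r :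
  polynomial_family plucker_coords U ->
  zariski_closed (fun x => (\rank (U x) <= r)%N : Prop).
Proof.
move=> [s [P defU]].
exists (fun D => exists f : {ffun 'I_r.+1 -> 'I_s},
  exists g : {ffun 'I_r.+1 -> 'I_p}, D = \det (mxsub f g P)) => x.
have minorE v (f : {ffun 'I_r.+1 -> 'I_s}) (g : {ffun 'I_r.+1 -> 'I_p}) :
    (\det (mxsub f g P)).@[v] = \det (mxsub f g (eval_mx v P)).
  by rewrite -det_map_mx map_mxsub.
split=> [rankU _ [f [g ->]] u basis_u | vanish].
  rewrite minorE.
  have [] := mxrank_le_minors r (eval_mx (plucker_coord u) P).
  by move=> + _; apply; rewrite (defU x) //; exists u.
pose u b := tcast (eqP (svalP (x b))) (vbasis (sval (x b))).
have basis_u b : basis_of (sval (x b)) (u b).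
  by rewrite /u val_tcast vbasisP.
have xu : plucker_coords x (plucker_coord u) by exists u.
rewrite -(defU x _ xu); apply/mxrank_le_minors => f g; rewrite -minorE.
by apply: vanish basis_u; exists f, g.
Qed.

Lemma polynomial_family_sum_row_comb q p (b : B)
    (f : 'I_(a b) -> 'M[F]_(q, p)) :
  polynomial_family plucker_coords
    (fun x => \sum_(w <- vbasis (sval (x b))) <<row_comb f w>>)%MS.
Proof.
pose h (J : minor_row (m b) (a b)) c : 'I_#|plucker_index m a| :=
  enum_rank (existT _ b (set_index J.1 J.2 c)).
apply: polynomial_family_coords (polynomial_family_sums (index_enum _) (fun J =>
  polynomial_family_genmx (polynomial_family_row_comb f (h J)))) _.
move=> x _ [u basis_u ->].
have -> : (\sum_J <<row_comb f (\row_c plucker_coord u (h J c))>>)%MS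
    = (\sum_(w <- map (plucker_vector (u b)) (index_enum _))
          <<row_comb f w>>)%MS.
  rewrite big_map; apply: eq_bigr => J _; congr (<<row_comb f _>>)%MS.
  by apply/rowP => c; rewrite !mxE /plucker_coord enum_rankK.
apply/eqmxP; rewrite !sum_row_comb_sub //;
  by rewrite (span_plucker_vector (basis_u b)) (span_basis (vbasisP _)).
Qed.

End ClosedRank.

(** With c the constant value of f + g on Z, the condition g <= c - (f x + 1)
means f > f x on Z.  Hence the closed sets f <= f x and g <= c - (f x + 1) cover
Z, and the second one does not contain x: the first one contains Z, for every
point x of Z. *)
Lemma irreducible_const (F : fieldType) (B : finType) (m a : B -> nat)
    (Z : set (grass_prod F m a)) (f g : grass_prod F m a -> nat) :
  irreducible Z ->
  (forall r, zariski_closed (fun x => (f x <= r)%N : Prop)) ->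
  (forall r, zariski_closed (fun x => (g x <= r)%N : Prop)) ->
  (forall x y, Z x -> Z y -> f x + g x = f y + g y)%N ->
  forall x y, Z x -> Z y -> f x = f y.
Proof.
move=> [_ irrZ] closed_f closed_g const_fg.
have le_f x y : Z x -> Z y -> (f y <= f x)%N.
  move=> Zx Zy; rewrite leqNgt; apply/negP => lt_xy.
  pose c := (f x + g x)%N.
  have fgE z : Z z -> (f z + g z = c)%N by move=> Zz; apply: const_fg.
  (* Without this bound the subtraction in c - (f x).+1 could be truncated. *)
  have lt_c : ((f x).+1 <= c)%N.
    by rewrite -(fgE y Zy) (leq_trans lt_xy) ?leq_addr.
  case: (irrZ _ _ (closed_f (f x)) (closed_g (c - (f x).+1)%N))
    => [z Zz|/(_ y Zy)|].
  - case: (leqP (f z) (f x)) => lt_fz; [by left | right].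
    by rewrite leq_subRL // -(fgE z Zz) leq_add2r.
  - by rewrite leqNgt lt_xy.
  by move/(_ x Zx); rewrite leq_subRL // addSn ltnn.
by move=> x y Zx Zy; apply/eqP; rewrite eqn_leq !le_f.
Qed.

(** * Isotypic projectors determine a representation *)

Section IsotypicProjectors.

Variables (F : decFieldType) (gT : finGroupType) (G : {group gT}).
Hypothesis F'G : ([pchar F]^'.-group G)%g.
Variable sG : irrType F G.

(** The projection of rG onto its isotypic part of type i: the action of the
central idempotent of the group ring that is the unit of the Wedderburn
component i. *)
Definition isotypic_proj n (rG : mx_representation F G n) (i : sG) : 'M_n :=
  gring_op rG (Wedderburn_id i).

Lemma Wedderburn_id_group_ring (i : sG) :
  (Wedderburn_id i \in group_ring F G)%MS.
Proof.
by rewrite -(Wedderburn_sum_pchar sG F'G) (sumsmx_sup i) ?Wedderburn_id_mem.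
Qed.

Lemma gring_opE_sum n (rG : mx_representation F G n) A :
  gring_op rG A = \sum_i gring_row A 0 i *: rG (enum_val i).
Proof.
rewrite gring_opE /gring_mx /= mulmx_sum_row linear_sum.
by apply: eq_bigr => i _; rewrite linearZ /= rowK mxvecK.
Qed.

Lemma gring_op_hom n1 n2 (rG1 : mx_representation F G n1)
    (rG2 : mx_representation F G n2) (f : 'M_(n1, n2)) A :
  (forall g, g \in G -> rG1 g *m f = f *m rG2 g) ->
  gring_op rG1 A *m f = f *m gring_op rG2 A.
Proof.
move=> homf; rewrite !gring_opE_sum mulmx_suml mulmx_sumr.
by apply: eq_bigr => i _; rewrite -scalemxAl -scalemxAr homf ?enum_valP.
Qed.

Section OneRepresentation.

Variables (n : nat) (rG : mx_representation F G n).
Local Notation E := (isotypic_proj rG).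

Lemma gring_opM A B : (B \in group_ring F G)%MS ->
  gring_op rG (A *m B) = gring_op rG A *m gring_op rG B.
Proof. by move=> RB; rewrite -(gring_rowK RB) gring_opJ gring_op_mx. Qed.

Lemma isotypic_proj_sum : \sum_i E i = 1%:M.
Proof. by rewrite -linear_sum /= Wedderburn_sum_id_pchar // gring_op1. Qed.

Lemma isotypic_proj_idem i : E i *m E i = E i.
Proof.
rewrite /isotypic_proj -gring_opM ?Wedderburn_id_group_ring //.
have [_ _ idl _] := Wedderburn_is_id_pchar F'G i.
by rewrite idl ?Wedderburn_id_mem.
Qed.

Lemma isotypic_proj_ortho i j : i != j -> E i *m E j = 0.
Proof.
move=> ne_ij; rewrite /isotypic_proj -gring_opM ?Wedderburn_id_group_ring //.
by rewrite (Wedderburn_mulmx0 ne_ij) ?Wedderburn_id_mem // linear0.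
Qed.

(** The idempotent e_i is a two-sided unit of the two-sided ideal that it
generates, so that e_i g = e_i g e_i = g e_i. *)
Lemma isotypic_proj_central i g : g \in G -> E i *m rG g = rG g *m E i.
Proof.
move=> Gg; have Rg : (regular_repr F G g \in group_ring F G)%MS.
  exact: envelop_mx_id.
rewrite -(gring_opG rG Gg) /isotypic_proj.
rewrite -!gring_opM ?Wedderburn_id_group_ring //.
have [_ _ idl idr] := Wedderburn_is_id_pchar F'G i.
have [ideall idealr] := andP (Wedderburn_ideal i).
have Re := Wedderburn_id_mem i.
congr gring_op; rewrite -[LHS]idr; last exact: (mulsmx_subP idealr).
by rewrite -mulmxA idl //; apply: (mulsmx_subP ideall).
Qed.

Lemma isotypic_proj_module i : mxmodule rG (E i).
Proof.
by apply/mxmoduleP => g Gg; rewrite isotypic_proj_central ?submxMl.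
Qed.

Lemma submodule_isotypic_proj m (U : 'M_(m, n)) i :
  mxmodule rG U -> (U *m E i <= U)%MS.
Proof.
move=> modU; rewrite /isotypic_proj gring_opE_sum mulmx_sumr.
apply: summx_sub => j _.
by rewrite -scalemxAr scalemx_sub ?(mxmoduleP modU) ?enum_valP.
Qed.

Lemma sub_isotypic_proj m (U : 'M_(m, n)) i :
  (U <= E i)%MS -> U *m E i = U.
Proof. by case/submxP=> D ->; rewrite -mulmxA isotypic_proj_idem. Qed.

Lemma capmx_isotypic_proj m (U : 'M_(m, n)) i :
  mxmodule rG U -> (U :&: E i :=: U *m E i)%MS.
Proof.
move=> modU; apply/eqmxP; rewrite sub_capmx submodule_isotypic_proj //.
rewrite submxMl !andbT.
rewrite -{1}[(U :&: E i)%MS](sub_isotypic_proj (i := i)) ?capmxSr //.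
by rewrite submxMr ?capmxSl.
Qed.

Lemma rank_isotypic_proj_compl m (U : 'M_(m, n)) i : mxmodule rG U ->
  (\rank (U *m E i) + \rank (U *m (1%:M - E i)))%N = \rank U.
Proof.
move=> modU; have sUE := submodule_isotypic_proj i modU.
rewrite -mxrank_disjoint_sum.
  apply: eqmx_rank; apply/andP; split.
    by rewrite addsmx_sub sUE mulmxBr mulmx1 addmx_sub ?eqmx_opp.
  have {1}-> : U = U *m E i + U *m (1%:M - E i).
    by rewrite -mulmxDr addrC subrK mulmx1.
  exact: addmx_sub_adds.
apply/eqP/rowV0P => v.
rewrite sub_capmx => /andP[/submxP[a ->] /submxP[b eq_ab]].
rewrite mulmxA -[E i]isotypic_proj_idem mulmxA -[a *m U *m E i]mulmxA eq_ab.
by rewrite -!mulmxA mulmxBl mul1mx isotypic_proj_idem subrr !mulmx0.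
Qed.

Lemma mxdirect_isotypic_proj : mxdirect (\sum_i E i)%MS.
Proof.
apply/mxdirect_sumsP => i _; apply/eqP; rewrite -submx0.
rewrite -[X in (X <= _)%MS](sub_isotypic_proj (i := i)) ?capmxSl //.
apply: submx_trans (submxMr _ (capmxSr _ _)) _; rewrite sumsmxMr.
by apply/sumsmx_subP => j ne_ji; rewrite isotypic_proj_ortho.
Qed.

Lemma sum_isotypic_proj : ((\sum_i E i)%MS :=: (1%:M : 'M_n))%MS.
Proof.
apply/eqmxP; rewrite submx1 -isotypic_proj_sum.
by apply: summx_sub => i _; apply: (sumsmx_sup i).
Qed.

(** The projector acts as the identity on M, whereas it would act as 0 if the
type of M were not i. *)
Lemma simple_isotypic_proj i (M : 'M_n) (modM : mxmodule rG M) :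
  mxsimple rG M -> (M <= E i)%MS -> mx_rsim (submod_repr modM) (irr_repr i).
Proof.
move=> simM sME; have irrM := (submod_mx_irr modM).2 simM.
have := rsim_irr_comp_pchar sG F'G irrM.
have [<- // | ne_i] := eqVneq i (irr_comp sG (submod_repr modM)).
have := irr_comp'_op0_pchar F'G irrM ne_i (Wedderburn_id_mem i) => E0.
have hom_val g : g \in G ->
    submod_repr modM g *m val_submod 1%:M = val_submod 1%:M *m rG g.
  by move=> Gg; rewrite -val_submodE -(val_submodJ modM) ?mul1mx.
have := gring_op_hom (Wedderburn_id i) hom_val; rewrite E0 mul0mx.
rewrite -/(E i) sub_isotypic_proj ?val_submod1 // => /esym/eqP.
rewrite val_submod_eq0 -mxrank_eq0 mxrank1.
by case/mx_irrP: irrM; rewrite lt0n => /negPf ->.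
Qed.

(** The image of the projector is semisimple by Maschke's theorem, and all its
simple summands have type i. *)
Lemma isotypic_proj_rsim i : {k |
  mx_rsim (submod_repr (isotypic_proj_module i))
    (muln_grepr (Representation (irr_repr i)) k)
  & \rank (E i) = (k * irr_degree i)%N}.
Proof.
have ssE : mxsemisimple rG (E i).
  have ss1 := Socle_semisimple (DecSocleType rG).
  rewrite reducible_Socle1 in ss1; last exact: mx_Maschke_pchar.
  exact: mxsemisimpleS (isotypic_proj_module i) (submx1 _) ss1.
case: ssE => I U /= simU defU dxU; exists #|I|.
  have modU j : mxmodule rG (U j) by case: (simU j).
  have -> : muln_grepr (Representation (irr_repr i)) #|I|
      = \big[@dadd_grepr _ _ _/@grepr0 _ _ _]_(j : I)
          Representation (irr_repr i).
    by rewrite /muln_grepr !big_const card_ord.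
  apply: (mx_rsim_dsum (modU := modU)) => // j.
  apply: simple_isotypic_proj (simU j) _.
  by rewrite -defU (sumsmx_sup j).
rewrite -defU (mxdirectP dxU) /= (eq_bigr (fun=> irr_degree i)) => [|j _].
  by rewrite sum_nat_const.
have modUj : mxmodule rG (U j) by case: (simU j).
have sUE : (U j <= E i)%MS by rewrite -defU (sumsmx_sup j).
by case: (simple_isotypic_proj modUj (simU j) sUE).
Qed.

Lemma mx_rsim_isotypic (k : sG -> nat) :
    (forall i, \rank (E i) = k i * irr_degree i)%N ->
  mx_rsim rG (\big[@dadd_grepr _ _ _/@grepr0 _ _ _]_i
                 muln_grepr (Representation (irr_repr i)) (k i)).
Proof.
move=> rankE.
apply: mx_rsim_trans (mx_rsim_sym (rsim_submod1 (mxmodule1 rG) _)) _ => //.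
apply: (mx_rsim_dsum (modU := isotypic_proj_module)) => [||i].
- exact: sum_isotypic_proj.
- exact: mxdirect_isotypic_proj.
have [k' rsimE rankE'] := isotypic_proj_rsim i.
have /eqP : (k i * irr_degree i = k' * irr_degree i)%N by rewrite -rankE.
by rewrite eqn_pmul2r ?irr_degree_gt0 // => /eqP ->.
Qed.

(** The canonical map to the quotient commutes with the projectors, so the rank
on the quotient is that of (U + im E i) / U; and U meets im E i in U *m E i. *)
Lemma rank_isotypic_proj_factmod (U : 'M_n) (modU : mxmodule rG U) i :
  (\rank (isotypic_proj (factmod_repr modU) i) + \rank (U *m E i))%N
  = \rank (E i).
Proof.
have hom_in g : g \in G ->
    rG g *m in_factmod U 1%:M = in_factmod U 1%:M *m factmod_repr modU g.
  by move=> Gg; rewrite -(in_factmodJ modU) // mul1mx -in_factmodE.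
have := gring_op_hom (Wedderburn_id i) hom_in; rewrite -/(E i) => homE.
have full_in : row_full (in_factmod U (1%:M : 'M_n)).
  rewrite /in_factmod /= mul1mx; exact: col_base_full.
have -> : \rank (isotypic_proj (factmod_repr modU) i)
    = \rank (in_factmod U (E i)).
  rewrite in_factmodE homE; apply/esym/eqmx_rank/eqmxP.
  exact: eqmxMfull full_in.
apply: (@addIn (\rank U)); rewrite addnAC mxrank_in_factmod.
rewrite -(capmx_isotypic_proj i modU) mxrank_sum_cap addnC //.
Qed.

End OneRepresentation.

(** Both representations are isomorphic to the same direct sum of copies of the
irr_repr i, the number of copies being the rank divided by the degree. *)
Lemma mx_rsim_of_rank_isotypic n1 n2 (rG1 : mx_representation F G n1)
    (rG2 : mx_representation F G n2) :
  (forall i, \rank (isotypic_proj rG1 i) = \rank (isotypic_proj rG2 i)) ->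
  mx_rsim rG1 rG2.
Proof.
move=> eq_rank; pose k i := s2val (isotypic_proj_rsim rG2 i).
have rank2 i : \rank (isotypic_proj rG2 i) = (k i * irr_degree i)%N.
  exact: (s2valP' (isotypic_proj_rsim rG2 i)).
apply: mx_rsim_trans (mx_rsim_sym (mx_rsim_isotypic rank2)).
by apply: mx_rsim_isotypic => i; rewrite eq_rank.
Qed.

Lemma factmod_rsim_of_rank_isotypic n (rG : mx_representation F G n)
    (U W : 'M_n) (modU : mxmodule rG U) (modW : mxmodule rG W) :
  (forall i,
     \rank (U *m isotypic_proj rG i) = \rank (W *m isotypic_proj rG i)) ->
  mx_rsim (factmod_repr modU) (factmod_repr modW).
Proof.
move=> eq_rank; apply: mx_rsim_of_rank_isotypic => i.
apply: (@addIn (\rank (U *m isotypic_proj rG i))).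
by rewrite {2}eq_rank !rank_isotypic_proj_factmod.
Qed.

End IsotypicProjectors.

(** * The ideals of the algebras parametrized by Z_k *)

Section DeformationFamily.

Variables (R : realType) (gT : finGroupType) (G : {group gT}) (n : nat).
Local Notation C := R[i]%C.
Variables (rV : mx_representation C G n) (A : G_algebra rV) (k : nat).
Local Notation coords :=
  (@plucker_coords C _ (mult_rel A (k := k)) (mult_tens rV (k := k))).

(** The multiplicity space of each simple S in the component of degree d is one
of the factors of x, and the isotypic part attached to it is the sum of its
images under a linear map with constant coefficients. *)
Lemma polynomial_family_point_rel d :
  polynomial_family coords (fun x : Zk A k => point_rel x d).
Proof.
case: d => [|i]; first exact: polynomial_family_const.
rewrite /point_rel.
(* The type of idP is reflect (i < k) (i < k); a case analysis on it requires
   that its boolean index alone be generalized. *)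
have reflect_ind b (r : reflect (i < k)%N b)
    (U : (i < k)%N -> Zk A k -> 'M[C]_(n ^ i.+1)) :
    (forall lt_ik, polynomial_family coords (U lt_ik)) ->
    polynomial_family coords
      (fun x => if r is ReflectT lt_ik then U lt_ik x else 0).
  by case: r => [lt_ik|_] polyU; [apply: polyU|apply: polynomial_family_const].
apply: (reflect_ind _ idP (fun lt_ik x => (\sum_(S : simples R G)
  @isotypic_sub _ _ _ _ S (tens_repr rV i.+1)
    (sval (x (Ordinal lt_ik, S))))%MS)).
move=> lt_ik; apply: polynomial_family_sums => S.
exact: (@polynomial_family_sum_row_comb C _ _ _ _ _ (Ordinal lt_ik, S)
  (tnth (vbasis (homG (irr_repr S) (tens_repr rV i.+1))))).
Qed.

Lemma polynomial_family_gen_ideal d :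
  polynomial_family coords (fun x : Zk A k => gen_ideal (point_rel x) d).
Proof.
elim: d => [|d IH] /=; first exact: (polynomial_family_point_rel 0).
apply: polynomial_family_adds; first exact: (polynomial_family_point_rel d.+1).
apply: polynomial_family_adds; apply: polynomial_family_genmx.
  apply: polynomial_family_castmx; apply: polynomial_family_tens IH.
  exact: polynomial_family_const.
do 2!apply: polynomial_family_castmx; apply: polynomial_family_tens IH _.
exact: polynomial_family_const.
Qed.

End DeformationFamily.

Theorem theorem1p1 (R : realType) (gT : finGroupType) (G : {group gT}) (n : nat)
    (rV : mx_representation R[i]%C G n) (A : G_algebra rV) (k : nat)
    (Z : set (Zk A k)) :
  irreducible Z ->
  parametrizes_up_to Z ->
  (forall x y, Z x -> Z y ->
     hilbert_series (algebra_at x) =1 hilbert_series (algebra_at y)) ->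
  parametrizes Z.
Proof.
move=> irrZ parZ eqH; split=> // x Zx d.
have [_ _ [x0 Zx0 [_ genA]]] := parZ.
have C'G : ([pchar R[i]%C]^'.-group G)%g.
  by apply/pgroupP => p _ _; rewrite inE /= Num.Theory.pchar_num.
pose I_ (y : Zk A k) : 'M_(n ^ d) := algebra_at y d.
have polyI : polynomial_family _ I_ := polynomial_family_gen_ideal A k d.
have modI y : mxmodule (tens_repr rV d) (I_ y).
  exact: relations_stable (algebra_at y) d.
have eq_rankI y z : Z y -> Z z -> \rank (I_ y) = \rank (I_ z).
  by move=> Zy Zz; apply: mxrank_coker_inj; apply: (eqH y z Zy Zz d).
apply: (factmod_rsim_of_rank_isotypic C'G (sG := simples R G)) => S.
set E := isotypic_proj _ _.
(* The point x0 of Z has the ideal of A, so A can be compared with A_x inside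
   the family. *)
rewrite -(eqmxMr E (genA d)).
apply: (irreducible_const (f := fun y => \rank (I_ y *m E))
  (g := fun y => \rank (I_ y *m (1%:M - E))) irrZ) => // [r|r|y z Zy Zz].
- exact/zariski_closed_rank_le/polynomial_family_mulmxr.
- exact/zariski_closed_rank_le/polynomial_family_mulmxr.
by rewrite !(rank_isotypic_proj_compl C'G) ?(eq_rankI y z).
Qed.
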